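(* Let $U$ be a nonempty finite set and let $\mathcal{I}$ be a semi-interval system on $U$ such that $\mathcal{D}(U,\mathcal{I})$ is a Boolean lattice. Then there is a Boolean sublattice of $\mathrm{Part}(U)$ that contains $\mathcal{D}(U,\mathcal{I})$ and has the largest size among all Boolean sublattices of $\mathrm{Part}(U)$.
   Context: $\mathrm{Part}(U)$ is the lattice of all partitions of $U$ ordered by refinement. A Boolean sublattice is a sublattice (closed under meet and join of $\mathrm{Part}(U)$) that is itself a Boolean lattice. A closure system $(U,\mathcal{Q})$ is a family $\mathcal{Q}\subseteq\wp(U)$ containing $U$ and closed under arbitrary intersections. A semi-interval system is a closure system $(U,\mathcal{I})$ satisfying: (I$_0$) $\emptyset\in\mathcal{I}$ and $\{x\}\in\mathcal{I}$ for all $x\in U$; (I$_1$) if $A,B\in\mathcal{I}$ and $A\cap B\neq\emptyset$, then $A\cup B\in\mathcal{I}$. $\mathcal{D}(U,\mathcal{I})$ is the set of all partitions of $U$ all of whose blocks belong to $\mathcal{I}$, ordered by refinement. *)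

(* Defs.v *)
From HB Require Import structures.
From mathcomp Require Import all_boot all_order.

Set Implicit Arguments.
Unset Strict Implicit.
Unset Printing Implicit Defensive.

Import Order.TTheory.

Record part (U : finType) : Type :=
  Part { blocks : {set {set U}}; blocksP : partition blocks [set: U] }.

HB.instance Definition _ (U : finType) := [isSub for @blocks U].
HB.instance Definition _ (U : finType) := [Finite of part U by <:].

Section PartitionLattice.

Variable U : finType.
Implicit Types (P Q S : part U) (x y : U).

Definition same_block P x y : bool := y \in pblock (blocks P) x.

Lemma same_block_equiv P : equivalence_rel (same_block P).
Proof.
by move=> x y z; apply: (pblock_equivalence (blocksP P)); rewrite inE.
Qed.

Lemma same_block_refl P : reflexive (same_block P).
Proof. by move=> x; case: (same_block_equiv P x x x). Qed.

Lemma same_block_sym P : symmetric (same_block P).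
Proof.
move=> x y; apply/idP/idP => h.
  by rewrite -((same_block_equiv P x y x).2 h) same_block_refl.
by rewrite -((same_block_equiv P y x y).2 h) same_block_refl.
Qed.

Lemma same_block_trans P : transitive (same_block P).
Proof. by move=> y x z xy; rewrite -((same_block_equiv P x y z).2 xy). Qed.

Lemma same_blockP P x y :
  reflect (exists2 A, A \in blocks P & (x \in A) && (y \in A))
          (same_block P x y).
Proof.
have /and3P[/eqP covP tiP _] := blocksP P.
have xP : x \in cover (blocks P) by rewrite covP inE.
apply: (iffP idP) => [xy | [A PA /andP[xA yA]]].
  by exists (pblock (blocks P) x); rewrite ?pblock_mem ?mem_pblock ?xP.
by rewrite /same_block (def_pblock tiP PA xA).
Qed.

Definition part_of (R : rel U) (eqiR : {in [set: U] & &, equivalence_rel R}) :=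
  Part (equivalence_partitionP eqiR).

Lemma same_block_part_of R eqiR x y :
  same_block (@part_of R eqiR) x y = R x y.
Proof. by apply: (pblock_equivalence_partition eqiR); rewrite inE. Qed.

Lemma same_block_inj P Q : same_block P =2 same_block Q -> P = Q.
Proof.
move=> eqPQ; apply: val_inj => /=.
rewrite -(equivalence_partition_pblock (blocksP P)).
rewrite -(equivalence_partition_pblock (blocksP Q)).
apply: eq_imset => x; apply/setP => y; rewrite !inE /=; exact: eqPQ.
Qed.

Definition refines P Q : bool :=
  [forall A in blocks P, exists B in blocks Q, A \subset B].

Lemma refinesP P Q :
  reflect (subrel (same_block P) (same_block Q)) (refines P Q).
Proof.
apply: (iffP forall_inP) => [ref x y | sub A PA].
  case/same_blockP=> A PA /andP[xA yA].
  have /exists_inP[B QB /subsetP sAB] := ref A PA.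
  by apply/same_blockP; exists B => //; rewrite !sAB.
have /and3P[/eqP covP tiP nP] := blocksP P.
have /set0Pn[x xA] : A != set0 by apply: contraNneq nP => <-.
have /and3P[/eqP covQ _ _] := blocksP Q.
apply/exists_inP; exists (pblock (blocks Q) x).
  by rewrite pblock_mem // covQ inE.
apply/subsetP => y yA; apply: (sub x y).
by apply/same_blockP; exists A => //; rewrite xA.
Qed.

Lemma refines_refl : reflexive refines.
Proof. by move=> P; apply/refinesP => x y. Qed.

Lemma refines_anti : antisymmetric refines.
Proof.
move=> P Q /andP[/refinesP PQ /refinesP QP].
by apply: same_block_inj => x y; apply/idP/idP => [/PQ|/QP].
Qed.

Lemma refines_trans : transitive refines.
Proof.
move=> Q P S /refinesP PQ /refinesP QS.
by apply/refinesP => x y /PQ /QS.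
Qed.

Fact part_display : Order.disp_t. Proof. exact: Order.Disp tt tt. Qed.

HB.instance Definition _ :=
  Order.Le_isPOrder.Build part_display (part U)
    refines_refl refines_anti refines_trans.

Definition part_meet_rel P Q : rel U :=
  fun x y => same_block P x y && same_block Q x y.

Lemma part_meet_rel_equiv P Q :
  {in [set: U] & &, equivalence_rel (part_meet_rel P Q)}.
Proof.
move=> x y z _ _ _; rewrite /part_meet_rel !same_block_refl; split=> //.
case/andP=> xyP xyQ.
by rewrite ((same_block_equiv P x y z).2 xyP) ((same_block_equiv Q x y z).2 xyQ).
Qed.

Definition part_meet P Q : part U := part_of (part_meet_rel_equiv P Q).

Definition part_join_rel P Q : rel U :=
  connect (fun x y => same_block P x y || same_block Q x y).

Lemma part_join_rel_equiv P Q :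
  {in [set: U] & &, equivalence_rel (part_join_rel P Q)}.
Proof.
have symc : connect_sym (fun x y => same_block P x y || same_block Q x y).
  by apply: sym_connect_sym => x y; rewrite !(same_block_sym _ x).
move=> x y z _ _ _; split; first exact: connect0.
by move=> xy; rewrite /part_join_rel (same_connect symc xy).
Qed.

Definition part_join P Q : part U := part_of (part_join_rel_equiv P Q).

Lemma part_meetP S P Q : refines S (part_meet P Q) = refines S P && refines S Q.
Proof.
apply/refinesP/andP => [sub | [/refinesP SP /refinesP SQ] x y xy].
  by split; apply/refinesP => x y /sub; rewrite same_block_part_of => /andP[].
by rewrite same_block_part_of; apply/andP; split; [apply: SP | apply: SQ].
Qed.

Lemma part_joinP P Q S : refines (part_join P Q) S = refines P S && refines Q S.
Proof.
apply/refinesP/andP => [sub | [/refinesP PS /refinesP QS] x y].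
  by split; apply/refinesP => x y xy; apply: sub;
     rewrite same_block_part_of; apply: connect1; rewrite xy ?orbT.
rewrite same_block_part_of => /connectP[p].
elim: p x => [x _ -> | z p IHp x /= /andP[xz pth] yE].
  exact: same_block_refl.
have Sxz : same_block S x z by case/orP: xz => [/PS|/QS].
exact: same_block_trans Sxz (IHp _ pth yE).
Qed.

HB.instance Definition _ :=
  Order.POrder_MeetJoin_isLattice.Build part_display (part U)
    part_meetP part_joinP.

End PartitionLattice.

(* The subset S, with the order induced from T, is a Boolean lattice: it is
   order isomorphic to some ctbDistrLatticeType. *)
Definition boolean_lattice d (T : finPOrderType d) (S : {set T}) : Prop :=
  exists (d' : Order.disp_t) (L : ctbDistrLatticeType d') (f : L -> T),
    {mono f : a b / (a <= b)%O} /\ (forall t : T, t \in S <-> exists a, t = f a).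

Definition boolean_sublattice d (T : finLatticeType d) (S : {set T}) : Prop :=
  [/\ meet_closed S, join_closed S & boolean_lattice S].

Definition closure_system (U : finType) (Q : {set {set U}}) : Prop :=
  [set: U] \in Q /\
  (forall F : {set {set U}}, F \subset Q -> \bigcap_(A in F) A \in Q).

Definition semi_interval_system (U : finType) (I : {set {set U}}) : Prop :=
  [/\ closure_system I,
      set0 \in I /\ (forall x : U, [set x] \in I)
    & forall A B : {set U},
        A \in I -> B \in I -> A :&: B != set0 -> A :|: B \in I].

Definition partitions_into (U : finType) (I : {set {set U}}) : {set part U} :=
  [set P : part U | blocks P \subset I].

(* Main.v *)
(* Let [D] be the lattice of partitions into members of [I], and let [T] be an
   inclusion-minimal set of pairs ("edges") such that every [P] in [D] is
   generated by the edges of [T] lying inside blocks of [P].  Then [T] is the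
   edge set of a tree.  Indeed, for [e] in [T], the least [R] in [D] joining the
   ends of [e] has a single nontrivial block, hence is a modular element of
   [part U]; if [Q] is a complement of [R] in [D], distributivity of [D] and
   minimality of [T] put every edge of [T] inside [R] or inside [Q], and
   modularity shows that a cycle through [e] would already lie inside [R],
   making [e] redundant.  The partitions into connected components of subsets
   of a tree form a Boolean lattice of size 2^(|U| - 1), which is the maximum
   because a distributive sublattice of [part U] has length at most |U| - 1. *)

Require Import Defs.
From mathcomp Require Import all_boot all_order.

Set Implicit Arguments.
Unset Strict Implicit.
Unset Printing Implicit Defensive.

Import Order.Theory Order.DefaultSetSubsetOrder.

(** * Boolean sublattices have at most 2^(|U| - 1) elements *)

Lemma connect_invariant (T : finType) (e : rel T) (K : pred T) x y :
  connect e x y -> K x -> (forall z t, K z -> e z t -> K t) -> K y.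
Proof.
move=> /connectP[p pth ->] Kx Kstep; elim: p x pth Kx => //= z p IHp x.
by case/andP=> xz pth Kx; apply: (IHp z) => //; apply: Kstep Kx xz.
Qed.

(** [boolean_lattice] only provides an order isomorphism [f]; closure of [S] under the ambient
    operations forces [f] to preserve meets and joins, so distributivity transfers. *)
Lemma boolean_sublattice_distr d (T : finLatticeType d) (S : {set T}) :
  boolean_sublattice S ->
  {in S & &, forall x y z, (x `&` (y `|` z) = (x `&` y) `|` (x `&` z))%O}.
Proof.
case=> capS cupS [d' [L [f [fM fS]]]].
have fcap a b : (f (a `&` b) = f a `&` f b)%O.
  have /fS[c ec] : (f a `&` f b)%O \in S by apply: capS; apply/fS; eexists.
  apply: le_anti; rewrite lexI !fM leIl leIr /= ec fM lexI -!fM -ec.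
  by rewrite leIl leIr.
have fcup a b : (f (a `|` b) = f a `|` f b)%O.
  have /fS[c ec] : (f a `|` f b)%O \in S by apply: cupS; apply/fS; eexists.
  apply: le_anti; rewrite leUx !fM leUl leUr /= ec fM leUx -!fM -ec.
  by rewrite leUl leUr.
move=> _ _ _ /fS[a ->] /fS[b ->] /fS[c ->].
by rewrite -!(fcup, fcap) meetUr.
Qed.

(** The bounds of [S] may differ from those of [T], so complementarity is expressed by comparison
    with the members of [S]. *)
Lemma boolean_sublattice_compl d (T : finLatticeType d) (S : {set T}) :
  boolean_sublattice S -> forall s, s \in S -> exists2 t, t \in S &
    {in S, forall u, (s `&` t <= u)%O /\ (u <= s `|` t)%O}.
Proof.
case=> capS cupS [d' [L [f [fM fS]]]] _ /fS[a ->].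
exists (f (~` a)%O); first by apply/fS; eexists.
have /fS[b eb] : (f a `&` f (~` a))%O \in S.
  by apply: capS; apply/fS; eexists.
have /fS[c ec] : (f a `|` f (~` a))%O \in S.
  by apply: cupS; apply/fS; eexists.
move=> _ /fS[u ->]; split.
  rewrite eb fM (le_trans _ (le0x u)) // -(meetxC a) lexI -!fM -eb.
  by rewrite leIl leIr.
rewrite ec fM (le_trans (lex1 u)) // -(joinxC a) leUx -!fM -ec.
by rewrite leUl leUr.
Qed.

Section Partitions.

Variable U : finType.
Implicit Types (P Q R S : part U) (x y z : U) (E F : {set U * U}).

Local Notation "P %: x" := (pblock (blocks P) x) (at level 30).

Lemma part_leP P Q :
  reflect (subrel (same_block P) (same_block Q)) (P <= Q)%O.
Proof. exact: refinesP. Qed.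

Lemma same_block_meet P Q x y :
  same_block (P `&` Q)%O x y = same_block P x y && same_block Q x y.
Proof. exact: same_block_part_of. Qed.

Lemma same_block_join P Q x y :
  same_block (P `|` Q)%O x y =
  connect (fun x y => same_block P x y || same_block Q x y) x y.
Proof. exact: same_block_part_of. Qed.

Lemma same_block_eq P x y : same_block P x y = (P %: x == P %: y).
Proof.
have /and3P[/eqP covP tiP _] := blocksP P.
by rewrite eq_pblock ?covP ?inE.
Qed.

Lemma pblock_block P x : P %: x \in blocks P.
Proof. by have /and3P[/eqP covP _ _] := blocksP P; rewrite pblock_mem ?covP. Qed.

Lemma blocks_pblock P X : X \in blocks P -> exists x, X = P %: x.
Proof.
have /and3P[_ tiP nP] := blocksP P => XP.
have /set0Pn[x xX] : X != set0 by apply: contraNneq nP => <-.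
by exists x; rewrite (def_pblock tiP XP xX).
Qed.

Lemma mem_pblockE P x y : (y \in P %: x) = same_block P x y.
Proof. by []. Qed.

Lemma blocks_coarsening P Q :
  (P <= Q)%O -> exists h : {set U} -> {set U}, forall x, h (P %: x) = Q %: x.
Proof.
move/part_leP=> PQ.
exists (fun X : {set U} => if [pick x in X] is Some x then Q %: x else set0) => x.
case: pickP => [y|/(_ x)]; last by rewrite mem_pblockE same_block_refl.
by rewrite mem_pblockE => /PQ; rewrite same_block_eq => /eqP.
Qed.

Lemma coarsening_blocks_sub P Q (h : {set U} -> {set U}) :
  (forall x, h (P %: x) = Q %: x) -> blocks Q \subset h @: blocks P.
Proof.
move=> hE; apply/subsetP=> X /blocks_pblock[x ->].
by apply/imsetP; exists (P %: x); rewrite ?pblock_block.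
Qed.

Lemma leq_card_blocks P Q : (P <= Q)%O -> #|blocks Q| <= #|blocks P|.
Proof.
case/blocks_coarsening=> h /coarsening_blocks_sub/subset_leq_card le_h.
exact: leq_trans le_h (leq_imset_card _ _).
Qed.

(** If the block counts agreed, the map [h] from blocks of [P] to blocks of [Q] would be injective,
    so [Q] could not join points that [P] separates. *)
Lemma ltn_card_blocks P Q : (P < Q)%O -> #|blocks Q| < #|blocks P|.
Proof.
rewrite lt_neqAle => /andP[neqPQ lePQ]; rewrite ltn_neqAle leq_card_blocks //.
rewrite andbT; apply: contra neqPQ => /eqP eqc.
have [h hE] := blocks_coarsening lePQ.
have /imset_injP h_inj : #|h @: blocks P| == #|blocks P|.
  rewrite eqn_leq leq_imset_card -eqc.
  exact: subset_leq_card (coarsening_blocks_sub hE).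
rewrite eq_le lePQ; apply/part_leP=> x y; rewrite !same_block_eq -!hE.
by move=> /eqP/h_inj-> //; apply: pblock_block.
Qed.

Lemma card_blocks_le P : #|blocks P| <= #|U|.
Proof.
rewrite (_ : blocks P = (fun x => P %: x) @: setT).
  by rewrite (leq_trans (leq_imset_card _ _)) ?cardsT.
apply/setP=> X; apply/idP/imsetP => [/blocks_pblock[x ->]|[x _ ->]].
  by exists x; rewrite ?inE.
exact: pblock_block.
Qed.

Lemma card_blocks_gt0 P : 0 < #|U| -> 0 < #|blocks P|.
Proof.
by case/card_gt0P=> x _; apply/card_gt0P; exists (P %: x); apply: pblock_block.
Qed.

(* If [d] is maximal in [C] strictly below [c], then [x |-> (x `&` d, x <= d)]
   is injective on the elements of [C] below [c]. *)
Lemma card_distr_below (C : {set part U}) c :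
    meet_closed C -> join_closed C ->
    {in C & &, forall P Q R, (P `&` (Q `|` R) = (P `&` Q) `|` (P `&` R))%O} ->
    c \in C ->
  #|[set P in C | (P <= c)%O]| <= 2 ^ (#|U| - #|blocks c|).
Proof.
move=> capC cupC distrC; have [n] := ubnP (#|U| - #|blocks c|).
elim: n c => // n IHn c lt_n Cc.
pose below d := [set P in C | (P <= d)%O].
have [|[d0 d0P]] := set_0Vmem [set d in C | (d < c)%O].
  move/setP=> none; rewrite (_ : [set P in C | _] = [set c]).
    by rewrite cards1 expn_gt0.
  apply/setP=> x; rewrite !inE; have := none x; rewrite !inE le_eqVlt.
  by case: eqVneq => [->|_]; rewrite ?Cc // => ->.
(* Having the most elements of [C] below it makes [d] order-maximal among the members of [C]
   strictly below [c]. *)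
have [d] := @arg_maxnP _ d0 [pred d in [set d in C | (d < c)%O]]
  (fun d => #|below d|) d0P.
rewrite /= !inE => /andP[Cd ltdc] d_max {d0 d0P}.
have d_cover (x : part U) : x \in C -> (x <= c)%O -> ~~ (x <= d)%O ->
    (x `|` d = c)%O.
  move=> Cx lexc nlexd; apply/eqP; apply: contraNT nlexd => neq.
  have /d_max : (x `|` d)%O \in [set d in C | (d < c)%O].
    by rewrite inE cupC //= lt_neqAle neq leUx lexc ltW.
  rewrite leqNgt; apply: contraR => nlexd.
  apply/proper_card/properP; split.
    by apply/subsetP=> y; rewrite !inE => /andP[-> /le_trans->]; rewrite ?leUr.
  by exists x; rewrite !inE Cx ?leUl.
pose g (x : part U) := ((x `&` d)%O, (x <= d)%O).
have g_inj : {in below c &, injective g}.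
  move=> x y; rewrite !inE => /andP[Cx lexc] /andP[Cy leyc] eqg.
  have eqI : (x `&` d = y `&` d)%O := congr1 fst eqg.
  have := congr1 snd eqg; rewrite /g [LHS]/= [RHS]/=.
  case: (boolP (x <= d)%O) => xd; case: (boolP (y <= d)%O) => yd // _.
    by rewrite -(meet_idPl xd) -(meet_idPl yd).
  (* By distributivity, an element is determined by its meet and its join with [d]. *)
  have eqU : (x `|` d = y `|` d)%O by rewrite !d_cover.
  have xE : (x = (x `&` y) `|` (x `&` d))%O by rewrite -distrC // -eqU joinKI.
  have yE : (y = (y `&` x) `|` (y `&` d))%O by rewrite -distrC // eqU joinKI.
  by rewrite [LHS]xE [RHS]yE eqI [(x `&` y)%O]meetC.
have lt_d := ltn_card_blocks ltdc.
have le_d := card_blocks_le d.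
have lt_sub : #|U| - #|blocks d| < #|U| - #|blocks c|.
  by apply: ltn_sub2l => //; exact: leq_trans lt_d le_d.
have {}IHn : #|below d| <= 2 ^ (#|U| - #|blocks d|).
  by apply: IHn => //; apply: leq_trans lt_sub _.
rewrite -(card_in_imset g_inj).
apply: (@leq_trans #|setX (below d) [set: bool]|).
  apply/subset_leq_card/subsetP=> _ /imsetP[x + ->].
  by rewrite !inE => /andP[Cx _]; rewrite capC //= leIr.
rewrite cardsX cardsT card_bool muln2 -mul2n.
apply: (leq_trans (leq_mul (leqnn 2) IHn)); by rewrite -expnS leq_exp2l.
Qed.

Lemma card_boolean_sublattice (C : {set part U}) :
  0 < #|U| -> boolean_sublattice C -> #|C| <= 2 ^ #|U|.-1.
Proof.
move=> U0 CB; have [capC cupC [d' [L [f [fM fC]]]]] := CB.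
have Ctop : f \top%O \in C by apply/fC; eexists.
have := card_distr_below capC cupC (boolean_sublattice_distr CB) Ctop.
rewrite (_ : [set P in C | _] = C) => [le_C|]; last first.
  apply/setP=> x; rewrite inE; case Cx: (x \in C) => //=.
  by have /fC[a ->] := Cx; rewrite fM lex1.
apply: (leq_trans le_C); rewrite leq_exp2l // -subn1 leq_sub2l //.
exact: card_blocks_gt0.
Qed.

End Partitions.

(** * Partitions generated by the edges of a forest *)

Section Spans.

Variable U : finType.
Implicit Types (P Q R S : part U) (x y z : U) (E F T : {set U * U}).

Definition edge_rel E : rel U := fun x y => ((x, y) \in E) || ((y, x) \in E).

Lemma edge_rel_connect_equiv E :
  {in [set: U] & &, equivalence_rel (connect (edge_rel E))}.
Proof.
have symE : connect_sym (edge_rel E).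
  by apply: sym_connect_sym => x y; rewrite /edge_rel orbC.
by move=> x y z _ _ _; split=> // xy; rewrite (same_connect symE xy).
Qed.

Definition span E : part U := part_of (@edge_rel_connect_equiv E).

Lemma span_ind E (K : pred U) x y :
  same_block (span E) x y -> K x ->
  (forall a b, (a, b) \in E -> K a = K b) -> K y.
Proof.
rewrite same_block_part_of => xy Kx Kstep; apply: connect_invariant xy Kx _.
by move=> z t Kz /orP[/Kstep <-|/Kstep ->].
Qed.

Lemma mem_span E x y : (x, y) \in E -> same_block (span E) x y.
Proof.
by move=> xy; rewrite same_block_part_of connect1 // /edge_rel xy.
Qed.

Lemma span_leP E P :
  reflect {in E, forall e, same_block P e.1 e.2} (span E <= P)%O.
Proof.
apply: (iffP (part_leP _ _)) => [sEP [x y] /mem_span/sEP //| sEP x y xy].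
apply: (span_ind xy) => [|a b /sEP /= ab]; first exact: same_block_refl.
by rewrite !(same_block_sym _ x) ((same_block_equiv P a b x).2 ab).
Qed.

Lemma spanS E F : E \subset F -> (span E <= span F)%O.
Proof. by move/subsetP=> sEF; apply/span_leP=> -[x y] /sEF/mem_span. Qed.

Lemma spanU E F : span (E :|: F) = (span E `|` span F)%O.
Proof.
apply: le_anti; rewrite leUx !spanS ?subsetUl ?subsetUr // !andbT.
apply/span_leP=> -[x y]; rewrite inE => /orP[]/mem_span xy.
  by apply: (part_leP _ _ (leUl _ _)).
by apply: (part_leP _ _ (leUr _ _)).
Qed.

(** The conclusion, as a predicate of [y], is constant along old and new edges: passing through the
    new edge twice gains nothing. *)
Lemma span_setU1 E a b x y : let S := same_block (span E) in
  same_block (span ((a, b) |: E)) x y ->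
  [|| S x y, S x a && S b y | S x b && S a y].
Proof.
move=> S xy; have Sxx z : S z z by apply: same_block_refl.
have SR z t u : S z t -> S u z = S u t.
  by move=> zt; rewrite /S !(same_block_sym _ u) ((same_block_equiv _ _ _ u).2 zt).
apply: (span_ind (K := fun z => [|| S x z, S x a && S b z | S x b && S a z]) xy).
  by rewrite Sxx.
move=> c d; rewrite !inE => /orP[/eqP[-> ->]|/mem_span cd]; last first.
  by rewrite !(SR _ _ _ cd).
by rewrite !Sxx !andbT; case: (S x a); case: (S x b); rewrite ?orbT.
Qed.

Lemma card_span E : #|U| <= #|blocks (span E)| + #|E|.
Proof.
have [n] := ubnP #|E|; elim: n E => // n IHn E ltn.
have [->|[[a b] abE]] := set_0Vmem E.
  rewrite cards0 addn0.
  have inj : injective (pblock (blocks (span set0))).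
    move=> x y /eqP; rewrite -same_block_eq => xy.
    apply/esym/eqP; apply: (span_ind (K := pred1 x) xy); first exact: eqxx.
    by move=> c d; rewrite inE.
  rewrite -cardsT -(card_imset _ inj); apply/subset_leq_card/subsetP.
  by move=> _ /imsetP[x _ ->]; apply: pblock_block.
pose P := span (E :\ (a, b)).
have [h hE] : exists h, forall x,
    h (pblock (blocks P) x) = pblock (blocks (span E)) x.
  by apply: blocks_coarsening; apply: spanS; apply: subD1set.
(* Restoring [(a, b)] can merge only the blocks of [a] and [b], so at most one block is lost. *)
have h_inj : {in blocks P :\ pblock (blocks P) b &, injective h}.
  move=> X Y /setD1P[nXb /blocks_pblock[x eX]] /setD1P[nYb /blocks_pblock[y eY]].
  move: nXb nYb; rewrite {}eX {}eY !hE -!same_block_eq => xb yb /eqP.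
  rewrite -same_block_eq -(setD1K abE) => /span_setU1.
  rewrite (same_block_sym _ b) (negbTE xb) (negbTE yb) andbF !orbF.
  by rewrite same_block_eq => /eqP.
have := IHn (E :\ (a, b)); rewrite -/P (cardsD1 (a, b) E) abE add1n.
rewrite (cardsD1 (a, b) E) abE add1n ltnS in ltn => /(_ ltn) le_U.
apply: leq_trans le_U _; rewrite addnS -addSn leq_add2r.
rewrite (cardsD1 (pblock (blocks P) b)) pblock_block add1n ltnS.
rewrite -(card_in_imset h_inj); apply/subset_leq_card/subsetP.
move=> _ /imsetP[X /setD1P[_ /blocks_pblock[x ->]] ->].
by rewrite hE pblock_block.
Qed.

(** Since pairs are read without orientation, this also excludes loops and opposite copies of an
    edge. *)
Definition acyclic T := {in T, forall e, ~~ same_block (span (T :\ e)) e.1 e.2}.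

(** An edge of [E] outside [F] would have its ends joined by [F], hence by the rest of [T]. *)
Lemma acyclic_span_le T E F :
  acyclic T -> E \subset T -> F \subset T ->
  (span E <= span F)%O = (E \subset F).
Proof.
move=> acT /subsetP ET FT; apply/idP/idP => [/span_leP sEF|/spanS //].
apply/subsetP=> e eE; have := acT e (ET e eE); apply: contraR => neF.
apply: (part_leP _ _ _ _ _ (sEF e eE)); apply: spanS.
by apply/subsetD1P.
Qed.

(* A path in [F] joining two points of a block of [span E] avoids every edge
   [e] of [F] outside [E], as otherwise [E] and the rest of [F] would reconnect
   the endpoints of [e]. *)
Lemma acyclic_spanI T E F :
  acyclic T -> E \subset T -> F \subset T ->
  span (E :&: F) = (span E `&` span F)%O.
Proof.
move=> acT ET FT; apply: le_anti.
rewrite lexI !spanS ?subsetIl ?subsetIr //=; apply/part_leP=> x y.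
rewrite same_block_meet => /andP[xyE xyF].
(* An inclusion-minimal [G] stands in for the path: removing any of its edges separates [x] from
   [y]. *)
have [G /minsetP[xyG Gmin] GF] :=
  @minset_exists _ (fun G => same_block (span G) x y) F xyF.
suff GE : G \subset E.
  by apply: (part_leP _ _ _ _ _ xyG); apply: spanS; rewrite subsetI GE.
apply/subsetP=> -[a b] abG; apply: contraT => abE.
have nxy : ~~ same_block (span (G :\ (a, b))) x y.
  apply/negP=> /Gmin/(_ (subD1set _ _)) GE.
  by move: abG; rewrite -GE !inE eqxx.
have abT : (a, b) \in T by apply: (subsetP FT); apply: (subsetP GF).
have /part_leP GT : (span (G :\ (a, b)) <= span (T :\ (a, b)))%O.
  by apply/spanS/setSD/(subset_trans GF).
have /part_leP ET' : (span E <= span (T :\ (a, b)))%O.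
  by apply/spanS/subsetD1P.
have /= := acT _ abT; have := span_setU1 (a := a) (b := b) (x := x) (y := y).
move=> /(_ (G :\ (a, b))); rewrite setD1K // => /(_ xyG).
rewrite (negbTE nxy) /= => /orP[]/andP[/GT xa /GT yb].
  rewrite (same_block_trans _ (same_block_trans (ET' _ _ xyE) _)) //.
    by rewrite same_block_sym.
  by rewrite same_block_sym.
rewrite same_block_sym (same_block_trans _ (same_block_trans (ET' _ _ xyE) _)) //.
  by rewrite same_block_sym.
by rewrite same_block_sym.
Qed.

Lemma acyclic_boolean_sublattice T :
  acyclic T -> boolean_sublattice [set span E | E in powerset T].
Proof.
move=> acT; split.
- move=> _ _ /imsetP[E + ->] /imsetP[F + ->]; rewrite !powersetE => ET FT.
  apply/imsetP; exists (E :&: F); last by rewrite (acyclic_spanI acT).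
  by rewrite powersetE subIset ?ET.
- move=> _ _ /imsetP[E + ->] /imsetP[F + ->]; rewrite !powersetE => ET FT.
  apply/imsetP; exists (E :|: F); last by rewrite spanU.
  by rewrite powersetE subUset ET.
(* The subsets of the subtype of edges serve as the model Boolean lattice. *)
pose K : finType := {e : U * U | e \in T}.
have sub_T (A : {set K}) : val @: A \subset T.
  by apply/subsetP=> _ /imsetP[e _ ->]; apply: valP.
exists _, {set K}.
exists (fun A : {set K} => span (val @: A)); split.
  move=> A B; rewrite (acyclic_span_le acT) //.
  rewrite Order.SetSubsetOrder.leEsubset.
  apply/subsetP/subsetP => [sAB e eA | sAB _ /imsetP[e eA ->]].
    have /imsetP[e' e'B /val_inj ->] // : val e \in val @: B.
    by apply: sAB; apply: imset_f.
  by apply: imset_f; apply: sAB.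
move=> P; split=> [/imsetP[E + ->] | [A ->]]; last first.
  by apply: imset_f; rewrite powersetE.
rewrite powersetE => ET; exists [set e : K | val e \in E]; congr span.
apply/setP=> e; apply/idP/imsetP => [eE | [e' + ->]]; last by rewrite inE.
by exists (exist _ e (subsetP ET e eE)); rewrite ?inE.
Qed.

Lemma card_acyclic_span T :
  acyclic T -> #|[set span E | E in powerset T]| = 2 ^ #|T|.
Proof.
move=> acT; rewrite card_in_imset ?card_powerset // => E F.
rewrite !powersetE => ET FT eqEF; apply/eqP.
rewrite eqEsubset -(acyclic_span_le acT ET) // -(acyclic_span_le acT FT) //.
by rewrite eqEF lexx.
Qed.

End Spans.

(** * A spanning tree adapted to a semi-interval system *)

Section OneBlock.

Variable U : finType.
Implicit Types (P Q R S : part U) (x y z : U) (A B : {set U}).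

(** The equality disjunct makes points outside [A] singletons; the empty [A] yields the discrete
    partition. *)
Definition one_block_rel A : rel U :=
  fun x y => (x == y) || (x \in A) && (y \in A).

Lemma one_block_rel_equiv A :
  {in [set: U] & &, equivalence_rel (one_block_rel A)}.
Proof.
move=> x y z _ _ _; rewrite /one_block_rel eqxx; split=> //.
case: eqVneq => [-> //|_ /= /andP[xA yA]]; rewrite xA yA /=.
by case: eqVneq => [<-|_]; case: eqVneq => [<-|]; rewrite ?xA ?yA.
Qed.

Definition one_block A : part U := part_of (@one_block_rel_equiv A).

Lemma same_block_one_block A x y :
  same_block (one_block A) x y = (x == y) || (x \in A) && (y \in A).
Proof. exact: same_block_part_of. Qed.

Lemma one_block_le A P x :
  x \in A -> (one_block A <= P)%O = (A \subset pblock (blocks P) x).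
Proof.
move=> xA; apply/part_leP/subsetP => [AP y yA | AP y z].
  by apply: AP; rewrite same_block_one_block xA yA orbT.
rewrite same_block_one_block => /orP[/eqP->|/andP[/AP xy /AP xz]].
  exact: same_block_refl.
by apply: same_block_trans xz; rewrite same_block_sym.
Qed.

(* One half of the fact that [one_block A] is a modular element of [part U]. *)
Lemma one_block_modular A S Q :
  (S <= one_block A)%O -> (one_block A `&` Q <= S)%O ->
  (one_block A `&` (S `|` Q) <= S)%O.
Proof.
move=> /part_leP SA /part_leP AQ; apply/part_leP=> x y.
rewrite same_block_meet same_block_join => /andP[Axy xy].
have [->|neq] := eqVneq x y; first exact: same_block_refl.
have /andP[xA yA] : (x \in A) && (y \in A).
  by move: Axy; rewrite same_block_one_block (negbTE neq).
have mid w z : same_block S x w -> same_block Q w z -> z \in A ->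
  same_block S x z.
  move=> xw wz zA; apply: (same_block_trans xw); apply: AQ.
  rewrite same_block_meet wz andbT same_block_one_block zA andbT.
  move: (SA _ _ xw); rewrite same_block_one_block xA.
  by case: eqVneq => [<-|_ /= ->]; rewrite ?xA orbT.
(* Every point reached from [x] is reached by one [S] step and then one [Q] step: a nontrivial [S]
   step starts in [A], where [mid] collapses the earlier steps into [S]. *)
have /existsP[w /andP[xw wy]] : [exists w, same_block S x w && same_block Q w y].
  apply: (connect_invariant (K := fun z =>
    [exists w, same_block S x w && same_block Q w z]) xy).
    by apply/existsP; exists x; rewrite !same_block_refl.
  move=> z t /existsP[w /andP[xw wz]] /orP[] zt; apply/existsP; last first.
    by exists w; rewrite xw (same_block_trans wz zt).
  have [<-|nzt] := eqVneq z t; first by exists w; rewrite xw.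
  have /andP[zA tA] : (z \in A) && (t \in A).
    by move: (SA _ _ zt); rewrite same_block_one_block (negbTE nzt).
  exists t; rewrite same_block_refl andbT.
  by apply: same_block_trans zt; apply: mid wz zA.
exact: mid wy yA.
Qed.

End OneBlock.

(** * Semi-interval systems and minimal spanning edge sets *)

Section SemiIntervals.

Variables (U : finType) (I : {set {set U}}).
Hypothesis hI : semi_interval_system I.
Implicit Types (P Q R S : part U) (x y z : U) (A B : {set U}).
Implicit Types (T E : {set U * U}) (e : U * U).

Local Notation D := (partitions_into I).

Lemma partitions_intoP P :
  reflect (forall x, pblock (blocks P) x \in I) (P \in D).
Proof.
rewrite inE; apply: (iffP subsetP) => [PI x | PI X /blocks_pblock[x ->]] //.
by apply: PI; apply: pblock_block.
Qed.

Lemma semi_interval_bigcap (F : {set {set U}}) :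
  F \subset I -> \bigcap_(A in F) A \in I.
Proof. by case: hI => -[_ +] _ _; apply. Qed.

Lemma partitions_into_meet : meet_closed D.
Proof.
move=> P Q /partitions_intoP PI /partitions_intoP QI; apply/partitions_intoP=> x.
have -> : pblock (blocks (P `&` Q)%O) x =
    \bigcap_(A in [set pblock (blocks P) x; pblock (blocks Q) x]) A.
  apply/setP=> y; rewrite mem_pblockE same_block_meet.
  apply/andP/bigcapP => [[xyP xyQ] A|xy]; first by rewrite !inE => /orP[]/eqP->.
  by split; apply: xy; rewrite !inE eqxx ?orbT.
apply: semi_interval_bigcap; apply/subsetP=> A.
by rewrite !inE => /orP[]/eqP->.
Qed.

(* A maximal member of [I] inside a block of the join swallows every block of
   [P] and [Q] that it meets, so it is that whole block. *)
Lemma partitions_into_join : join_closed D.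
Proof.
move=> P Q /partitions_intoP PI /partitions_intoP QI; apply/partitions_intoP=> x.
have [_ [_ I1] IU] := hI; set B := pblock _ x.
have xB : x \in B by rewrite mem_pblockE same_block_refl.
have [|A /maxsetP[/andP[AI AB] Amax] xA] :=
  @maxset_exists _ (fun A => (A \in I) && (A \subset B)) [set x].
  by rewrite I1 sub1set.
rewrite sub1set in xA; suff -> : B = A by [].
apply/eqP; rewrite eqEsubset AB andbT; apply/subsetP=> y.
rewrite mem_pblockE same_block_join => xy.
apply: (connect_invariant (K := fun z => z \in A) xy) => // z t zA zt.
have swallow R : (forall x, pblock (blocks R) x \in I) -> (R <= P `|` Q)%O ->
    same_block R z t -> t \in A.
  move=> RI /part_leP RPQ Rzt; rewrite -(Amax (A :|: pblock (blocks R) z)).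
  - by rewrite inE mem_pblockE Rzt orbT.
  - rewrite IU //= ?subUset ?AB /=; last first.
      by apply/set0Pn; exists z; rewrite inE zA mem_pblockE same_block_refl.
    apply/subsetP=> u /RPQ; rewrite mem_pblockE; apply: same_block_trans.
    exact: (subsetP AB).
  - exact: subsetUl.
by case/orP: zt; apply: swallow; rewrite ?leUl ?leUr.
Qed.

Lemma one_block_partition A : A \in I -> one_block A \in D.
Proof.
move=> AI; have [_ [_ I1] _] := hI; apply/partitions_intoP=> x.
case xA: (x \in A).
  suff -> : pblock (blocks (one_block A)) x = A by [].
  apply/setP=> y; rewrite mem_pblockE same_block_one_block xA /=.
  by case: eqVneq => [<-|].
suff -> : pblock (blocks (one_block A)) x = [set x] by [].
by apply/setP=> y; rewrite mem_pblockE same_block_one_block xA orbF inE eq_sym.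
Qed.

Definition interval e : {set U} :=
  \bigcap_(A in [set A in I | (e.1 \in A) && (e.2 \in A)]) A.

Definition principal e : part U := one_block (interval e).

Lemma principal_partition e : principal e \in D.
Proof.
apply: one_block_partition; apply: semi_interval_bigcap.
by apply/subsetP=> A; rewrite inE => /andP[].
Qed.

(** If [P] joins the ends of [e], their common block is a member of [I] containing both, so it
    contains [interval e]. *)
Lemma principal_le P e :
  P \in D -> (principal e <= P)%O = same_block P e.1 e.2.
Proof.
move/partitions_intoP=> PI; rewrite (@one_block_le _ _ _ e.1); last first.
  by apply/bigcapP=> A; rewrite inE => /and3P[].
apply/subsetP/idP => [|e12 x /bigcapP]; last first.
  by apply; rewrite inE PI !mem_pblockE same_block_refl.
by apply; apply/bigcapP=> A; rewrite inE => /and3P[].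
Qed.

Definition edges_in P T := [set e in T | same_block P e.1 e.2].

Lemma span_edges_in P T : (span (edges_in P T) <= P)%O.
Proof. by apply/span_leP=> e; rewrite inE => /andP[]. Qed.

Definition spanning T := [forall P in D, (P <= span (edges_in P T))%O].

(** Otherwise [e] could be dropped: any [P] in [D] joining its ends lies above [principal e], so the
    replacement edges lie inside [P] too. *)
Lemma minimal_spanning_redundant T e :
  minset spanning T -> e \in T ->
  ~~ same_block (span (edges_in (principal e) (T :\ e))) e.1 e.2.
Proof.
move=> /minsetP[/forall_inP spT Tmin] eT; apply/negP=> red.
suff /Tmin/(_ (subD1set _ _)) TE : spanning (T :\ e).
  by move: eT; rewrite -TE !inE eqxx.
apply/forall_inP=> P PD; apply: le_trans (spT P PD) _; apply/span_leP=> e'.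
rewrite inE => /andP[e'T Pe']; have [ee'|ne] := eqVneq e' e; last first.
  by apply: mem_span; rewrite -surjective_pairing !inE ne e'T.
rewrite ee' in Pe' *; apply: (part_leP _ _ _ _ _ red).
apply/spanS/subsetP=> e''; rewrite !inE => /andP[-> /=].
by apply: (part_leP _ _ _); rewrite principal_le.
Qed.

(** * Acyclicity of minimal spanning sets in the Boolean case *)

Hypothesis hD : boolean_lattice D.

Lemma partitions_into_sublattice : boolean_sublattice D.
Proof.
by split=> //; [apply: partitions_into_meet | apply: partitions_into_join].
Qed.

(** By distributivity [N] is the join of its meets with [R] and [Q]. If neither joins the ends of
    [e], both meets are generated by edges in [N] other than [e], making [e] redundant. *)
Lemma minimal_spanning_split T e R Q :
  minset spanning T -> e \in T -> R \in D -> Q \in D ->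
  (principal e <= R `|` Q)%O -> same_block R e.1 e.2 || same_block Q e.1 e.2.
Proof.
move=> minT eT RD QD leRQ; set N := principal e.
have ND : N \in D := principal_partition e.
have [/forall_inP spT _] := minsetP minT.
have := minimal_spanning_redundant minT eT; rewrite -/N.
apply: contraR; rewrite negb_or => /andP[nR nQ].
have NE : (N = (N `&` R) `|` (N `&` Q))%O.
  rewrite -(boolean_sublattice_distr partitions_into_sublattice) //.
  by rewrite (meet_idPl leRQ).
have sub P : P \in D -> ~~ same_block P e.1 e.2 ->
    (N `&` P <= span (edges_in N (T :\ e)))%O.
  move=> PD nP; apply: le_trans (spT _ (partitions_into_meet ND PD)) _.
  apply/spanS/subsetP=> e'; rewrite !inE same_block_meet => /and3P[-> -> Pe'].
  by rewrite !andbT; apply: contraNneq nP => <-.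
have : same_block N e.1 e.2 by rewrite -principal_le.
by apply: (part_leP _ _ _); rewrite NE leUx -NE !sub.
Qed.

Lemma minimal_spanning_acyclic T : minset spanning T -> acyclic T.
Proof.
move=> minT e eT; have := minimal_spanning_redundant minT eT.
apply: contra => cyc; set R := principal e; set S := span _.
have RD : R \in D := principal_partition e.
have [Q QD compl] := boolean_sublattice_compl partitions_into_sublattice RD.
have discrete : (R `&` Q <= S)%O.
  (* The discrete partition, as [one_block] of the empty set, lies in [D], so the meet of [R] and
     [Q] is below it. *)
  have [[_ _] [I0 _] _] := hI; have [+ _] := compl _ (one_block_partition I0).
  move/le_trans; apply; apply/part_leP=> x y.
  rewrite same_block_one_block !inE orbF => /eqP->; exact: same_block_refl.
suff /part_leP : (R `&` (S `|` Q) <= S)%O.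
  apply; rewrite same_block_meet -principal_le // lexx /=.
  apply: (part_leP _ _ _ _ _ cyc); apply/span_leP=> e'; rewrite inE => e'T.
  (* The join of [R] and [Q] is above all of [D], so each remaining edge lies in [R], hence among
     the generators of [S], or in [Q]. *)
  have /orP[Re'|Qe'] : same_block R e'.1 e'.2 || same_block Q e'.1 e'.2.
  - have [_ e'T'] := andP e'T; apply: (minimal_spanning_split minT) => //.
    by have [_] := compl _ (principal_partition e').
  - apply: (part_leP _ _ (leUl S Q)); apply: mem_span.
    by rewrite -surjective_pairing !inE Re' andbT; rewrite inE in e'T.
  - exact: (part_leP _ _ (leUr Q S)).
exact: one_block_modular (span_edges_in _ _) discrete.
Qed.

Lemma partitions_into_acyclic :
  exists T, acyclic T /\ {in D, forall P, P = span (edges_in P T)}.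
Proof.
(* The set of all pairs is spanning, so a minimal spanning set exists. *)
have [|T minT _] := @minset_exists _ spanning setT.
  apply/forall_inP=> P _; apply/part_leP=> x y xy; apply: mem_span.
  by rewrite !inE.
exists T; split=> [|P PD]; first exact: minimal_spanning_acyclic.
have [/forall_inP/(_ P PD) leP _] := minsetP minT.
by apply: le_anti; rewrite leP span_edges_in.
Qed.

End SemiIntervals.

Theorem corollary4p5 (U : finType) (I : {set {set U}})
    (hU : 0 < #|U|)
    (hI : semi_interval_system I)
    (hD : boolean_lattice (partitions_into I)) :
  exists B : {set part U},
    [/\ boolean_sublattice B,
        partitions_into I \subset B
      & forall C : {set part U}, boolean_sublattice C -> #|C| <= #|B|].
Proof.
have [T [acT spT]] := partitions_into_acyclic hI hD.
exists [set span E | E in powerset T]; split.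
- exact: acyclic_boolean_sublattice.
- apply/subsetP=> P /spT ->; apply: imset_f; rewrite powersetE.
  by apply/subsetP=> e; rewrite inE => /andP[].
move=> C /(card_boolean_sublattice hU)/leq_trans; apply.
rewrite card_acyclic_span // leq_exp2l // -ltnS prednK //.
(* It remains to see that [span T] has at most one block. As the whole of [U] is in [I], the
   one-block partition is in [D] and hence is generated by [T]. *)
apply: leq_trans (card_span T) _; rewrite -add1n leq_add2r.
have [[UI _] _ _] := hI.
have topT : (one_block [set: U] <= span T)%O.
  rewrite (spT _ (one_block_partition hI UI)); apply: spanS.
  by apply/subsetP=> e; rewrite inE => /andP[].
apply: leq_trans (leq_card_blocks topT) _; apply/card_le1_eqP => X Y.
move=> /blocks_pblock[x ->] /blocks_pblock[y ->]; apply/eqP.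
by rewrite -same_block_eq same_block_one_block !inE orbT.
Qed.
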